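(* Let $n\ge2$. The map $B:\mathbf C(T)\to\overline{\mathbf T}(T)$, $\alpha\mapsto h$, $$h_{XYZ}=\tfrac12\eta(Y)\alpha(X,\xi,FZ)-\eta(Z)\alpha(X,\xi,FY)+\tfrac12\alpha(X,Y,FZ),\qquad X,Y,Z\in T,$$ (which sends $(\nabla\Phi)_p$ to the second fundamental tensor $h_p$ of an almost contact metric structure) is a linear isomorphism identifying the two classifications of almost contact metric structures, with the following correspondence between the classes: $$B(\mathbf C_1)=\overline{\mathbf T}_1,\ B(\mathbf C_2)=\overline{\mathbf T}_2,\ B(\mathbf C_3)=\overline{\mathbf T}_3,\ B(\mathbf C_4)=\overline{\mathbf T}_4,\ B(\mathbf C_5)=\overline{\mathbf T}_{10},\ B(\mathbf C_6)=\overline{\mathbf T}_7,$$ $$B(\mathbf C_7)=\overline{\mathbf T}_5,\ B(\mathbf C_8)=\overline{\mathbf T}_8,\ B(\mathbf C_9)=\overline{\mathbf T}_9,\ B(\mathbf C_{10})=\overline{\mathbf T}_6,\ B(\mathbf C_{11})=\overline{\mathbf T}_{12},\ B(\mathbf C_{12})=\overline{\mathbf T}_{11}.$$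
   Context: $T$ is a real vector space of dimension $2n+1$ with inner product $\langle\,,\rangle$, $\xi\in T$ a unit vector, $\eta(X)=\langle X,\xi\rangle$, $V=\xi^\perp$, $F:T\to T$ linear with $F\xi=0$, $F(V)\subset V$, $F^2=-I$ on $V$, $\langle FX,FY\rangle=\langle X,Y\rangle$ on $V$; $\Phi(X,Y)=\langle X,FY\rangle$. $E_1,\dots,E_n,FE_1,\dots,FE_n,\xi$ is an orthonormal basis of $T$. $\mathfrak S$ is the cyclic sum over $X,Y,Z$. **The space $\mathbf C(T)$** consists of all $\alpha\in\otimes^3T^*$ with $\alpha(X,Y,Z)=-\alpha(X,Z,Y)=-\alpha(X,FY,FZ)+\eta(Y)\alpha(X,\xi,Z)+\eta(Z)\alpha(X,Y,\xi)$ for all $X,Y,Z\in T$ ($\alpha$ plays the role of $\nabla\Phi$). For $\alpha\in\mathbf C(T)$ put $(\nabla_X\eta)Y=\alpha(X,\xi,FY)$; $\delta\Phi(X)=-\sum_{i=1}^n[\alpha(E_i,E_i,X)+\alpha(FE_i,FE_i,X)]-\alpha(\xi,\xi,X)$; $\delta\eta=-\sum_{i=1}^n[(\nabla_{E_i}\eta)E_i+(\nabla_{FE_i}\eta)FE_i]$. $\mathbf C_i$ is the set of $\alpha\in\mathbf C(T)$ satisfying, for all $X,Y,Z\in T$: $\mathbf C_1$: $\alpha(X,X,Y)=0$, $\nabla\eta=0$; $\mathbf C_2$: $\mathfrak S\,\alpha(X,Y,Z)=0$, $\nabla\eta=0$; $\mathbf C_3$: $\alpha(X,Y,Z)-\alpha(FX,FY,Z)=0$,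 $\delta\Phi=0$; $\mathbf C_4$: $\alpha(X,Y,Z)=-\frac1{2(n-1)}[\langle FX,FY\rangle\delta\Phi(Z)-\langle FX,FZ\rangle\delta\Phi(Y)-\Phi(X,Y)\delta\Phi(FZ)+\Phi(X,Z)\delta\Phi(FY)]$, $\delta\Phi(\xi)=0$; $\mathbf C_5$: $\alpha(X,Y,Z)=\frac1{2n}[\Phi(X,Z)\eta(Y)-\Phi(X,Y)\eta(Z)]\delta\eta$; $\mathbf C_6$: $\alpha(X,Y,Z)=\frac1{2n}[\langle X,Z\rangle\eta(Y)-\langle X,Y\rangle\eta(Z)]\delta\Phi(\xi)$; $\mathbf C_7$: $\alpha(X,Y,Z)=\eta(Z)(\nabla_Y\eta)FX+\eta(Y)(\nabla_{FX}\eta)Z$, $\delta\Phi=0$; $\mathbf C_8$: $\alpha(X,Y,Z)=-\eta(Z)(\nabla_Y\eta)FX+\eta(Y)(\nabla_{FX}\eta)Z$, $\delta\eta=0$; $\mathbf C_9$: $\alpha(X,Y,Z)=\eta(Z)(\nabla_Y\eta)FX-\eta(Y)(\nabla_{FX}\eta)Z$; $\mathbf C_{10}$: $\alpha(X,Y,Z)=-\eta(Z)(\nabla_Y\eta)FX-\eta(Y)(\nabla_{FX}\eta)Z$; $\mathbf C_{11}$: $\alpha(X,Y,Z)=-\eta(X)\alpha(\xi,FY,FZ)$; $\mathbf C_{12}$: $\alpha(X,Y,Z)=\eta(X)\eta(Z)(\nabla_\xi\eta)FY-\eta(X)\eta(Y)(\nabla_\xi\eta)FZ$. **The space $\overline{\mathbf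 T}(T)$** consists of $h\in\otimes^3T^*$ with $h_{XYZ}=-h_{XZY}$ for $X,Y,Z\in T$ and $h_{XYZ}=-h_{X\,FY\,FZ}$ for $X\in T$, $Y,Z\in V$. Put $\beta(U)=\sum_{i=1}^n(h_{E_iE_iU}+h_{FE_iFE_iU})$, $\overline\beta(U)=\sum_{i=1}^n(h_{E_i\,FE_i\,U}-h_{FE_i\,E_i\,U})$. $\overline{\mathbf T}_i$ is the set of $h\in\overline{\mathbf T}(T)$ satisfying, for all $X,Y,Z\in V$: $\overline{\mathbf T}_1$: $h_{XYZ}=-h_{YXZ}$, $h_{XY\xi}=h_{\xi X\xi}=h_{\xi XY}=0$; $\overline{\mathbf T}_2$: $\mathfrak S\,h_{XYZ}=0$, $h_{XY\xi}=h_{\xi X\xi}=h_{\xi XY}=0$; $\overline{\mathbf T}_3$: $h_{XYZ}-h_{FX\,FY\,Z}=\beta(Z)=0$, $h_{XY\xi}=h_{\xi X\xi}=h_{\xi XY}=0$; $\overline{\mathbf T}_4$: $h_{XYZ}=\frac1{2(n-1)}(\langle X,Y\rangle\beta(Z)-\langle X,Z\rangle\beta(Y)-\langle X,FY\rangle\beta(FZ)+\langle X,FZ\rangle\beta(FY))$, $h_{XY\xi}=h_{\xi X\xi}=h_{\xi XY}=0$; $\overline{\mathbf T}_5$: $h_{XY\xi}=-h_{YX\xi}$, $h_{FX\,FY\,\xi}=h_{XY\xi}$, $\overline\beta(\xi)=0$, $h_{XYZ}=h_{\xi X\xi}=h_{\xi XY}=0$; $\overline{\mathbf T}_6$: $h_{XY\xi}=-h_{YX\xi}$,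 $h_{FX\,FY\,\xi}=-h_{XY\xi}$, $h_{XYZ}=h_{\xi X\xi}=h_{\xi XY}=0$; $\overline{\mathbf T}_7$: $h_{XY\xi}=-\frac1{2n}\langle X,FY\rangle\overline\beta(\xi)$, $h_{XYZ}=h_{\xi X\xi}=h_{\xi XY}=0$; $\overline{\mathbf T}_8$: $h_{XY\xi}=h_{YX\xi}$, $h_{FX\,FY\,\xi}=h_{XY\xi}$, $\beta(\xi)=0$, $h_{XYZ}=h_{\xi X\xi}=h_{\xi XY}=0$; $\overline{\mathbf T}_9$: $h_{XY\xi}=h_{YX\xi}$, $h_{FX\,FY\,\xi}=-h_{XY\xi}$, $h_{XYZ}=h_{\xi X\xi}=h_{\xi XY}=0$; $\overline{\mathbf T}_{10}$: $h_{XY\xi}=\frac1{2n}\langle X,Y\rangle\beta(\xi)$, $h_{XYZ}=h_{\xi X\xi}=h_{\xi XY}=0$; $\overline{\mathbf T}_{11}$: $h_{XYZ}=h_{XY\xi}=h_{\xi XY}=0$; $\overline{\mathbf T}_{12}$: $h_{\xi XY}=-h_{\xi YX}=-h_{\xi\,FX\,FY}$, $h_{XYZ}=h_{XY\xi}=h_{\xi X\xi}=0$. *)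

(* Defs.v *)
From mathcomp Require Import all_boot all_order all_algebra.
From mathcomp Require Import all_classical reals.

Set Implicit Arguments.
Unset Strict Implicit.
Unset Printing Implicit Defensive.

Import Order.TTheory GRing.Theory Num.Theory.
Local Open Scope classical_set_scope.
Local Open Scope ring_scope.

Section AlmostContactMetric.
Variables (R : realType) (n : nat) (T : vectType R).
Variables (dot : {dot T for idfun}) (xi : T) (F : {linear T -> T}).
Variable E : 'I_n -> T.

Local Notation "''[' X , Y ]" := (dot X Y).

Definition eta (X : T) : R := '[X, xi].

Definition Phi (X Y : T) : R := '[X, F Y].

Definition xi_perp : set T := [set X | '[X, xi] = 0].

Record almost_contact_metric : Prop := AlmostContactMetric {
  acm_xi_unit : '[xi, xi] = 1;
  acm_F_xi : F xi = 0;
  acm_F_perp : forall X, xi_perp X -> xi_perp (F X);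
  acm_F_sqr : forall X, xi_perp X -> F (F X) = - X;
  acm_F_isom : forall X Y, xi_perp X -> xi_perp Y -> '[F X, F Y] = '[X, Y]
}.

Definition frame : seq T :=
  [seq E i | i <- enum 'I_n] ++ [seq F (E i) | i <- enum 'I_n] ++ [:: xi].

Definition orthonormal_frame : Prop :=
  basis_of fullv frame /\ orthonormal dot frame.

(* The lmodType structure on this function type is the pointwise one. The
   elements of the third tensor power of the dual of T are the functions
   satisfying [trilinear]. *)
Definition ternary_fun : lmodType R := T -> T -> T -> R^o.

Implicit Types a h : ternary_fun.

Definition trilinear a : Prop :=
  [/\ forall Y Z, scalar (fun X => a X Y Z),
      forall X Z, scalar (fun Y => a X Y Z)
    & forall X Y, scalar (fun Z => a X Y Z)].

Definition C_space : set ternary_fun := [set a | trilinear a /\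
  forall X Y Z, a X Y Z = - a X Z Y /\
    - a X Z Y = - a X (F Y) (F Z) + eta Y * a X xi Z + eta Z * a X Y xi].

(* [nabla_eta a X Y] is the value at Y of the covariant derivative of eta in
   the direction X, when [a] is the covariant derivative of Phi. *)
Definition nabla_eta a (X Y : T) : R := a X xi (F Y).

Definition delta_Phi a (X : T) : R :=
  - (\sum_(i < n) (a (E i) (E i) X + a (F (E i)) (F (E i)) X)) - a xi xi X.

Definition delta_eta a : R :=
  - \sum_(i < n) (nabla_eta a (E i) (E i) + nabla_eta a (F (E i)) (F (E i))).

Definition C1 : set ternary_fun := [set a | [/\ C_space a,
  forall X Y, a X X Y = 0 & forall X Y, nabla_eta a X Y = 0]].

Definition C2 : set ternary_fun := [set a | [/\ C_space a,
  forall X Y Z, a X Y Z + a Y Z X + a Z X Y = 0 &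
  forall X Y, nabla_eta a X Y = 0]].

Definition C3 : set ternary_fun := [set a | [/\ C_space a,
  forall X Y Z, a X Y Z - a (F X) (F Y) Z = 0 &
  forall X, delta_Phi a X = 0]].

Definition C4 : set ternary_fun := [set a | [/\ C_space a,
  forall X Y Z, a X Y Z = - (2 * (n%:R - 1))^-1 *
    ('[F X, F Y] * delta_Phi a Z - '[F X, F Z] * delta_Phi a Y
     - Phi X Y * delta_Phi a (F Z) + Phi X Z * delta_Phi a (F Y)) &
  delta_Phi a xi = 0]].

Definition C5 : set ternary_fun := [set a | C_space a /\
  forall X Y Z, a X Y Z =
    (2 * n%:R)^-1 * (Phi X Z * eta Y - Phi X Y * eta Z) * delta_eta a].

Definition C6 : set ternary_fun := [set a | C_space a /\
  forall X Y Z, a X Y Z =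
    (2 * n%:R)^-1 * ('[X, Z] * eta Y - '[X, Y] * eta Z) * delta_Phi a xi].

Definition C7 : set ternary_fun := [set a | [/\ C_space a,
  forall X Y Z, a X Y Z =
    eta Z * nabla_eta a Y (F X) + eta Y * nabla_eta a (F X) Z &
  forall X, delta_Phi a X = 0]].

Definition C8 : set ternary_fun := [set a | [/\ C_space a,
  forall X Y Z, a X Y Z =
    - (eta Z * nabla_eta a Y (F X)) + eta Y * nabla_eta a (F X) Z &
  delta_eta a = 0]].

Definition C9 : set ternary_fun := [set a | C_space a /\
  forall X Y Z, a X Y Z =
    eta Z * nabla_eta a Y (F X) - eta Y * nabla_eta a (F X) Z].

Definition C10 : set ternary_fun := [set a | C_space a /\
  forall X Y Z, a X Y Z =
    - (eta Z * nabla_eta a Y (F X)) - eta Y * nabla_eta a (F X) Z].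

Definition C11 : set ternary_fun := [set a | C_space a /\
  forall X Y Z, a X Y Z = - (eta X * a xi (F Y) (F Z))].

Definition C12 : set ternary_fun := [set a | C_space a /\
  forall X Y Z, a X Y Z =
    eta X * eta Z * nabla_eta a xi (F Y) - eta X * eta Y * nabla_eta a xi (F Z)].

Definition T_space : set ternary_fun := [set h | [/\ trilinear h,
  forall X Y Z, h X Y Z = - h X Z Y &
  forall X Y Z, xi_perp Y -> xi_perp Z -> h X Y Z = - h X (F Y) (F Z)]].

Definition beta h (U : T) : R :=
  \sum_(i < n) (h (E i) (E i) U + h (F (E i)) (F (E i)) U).

Definition beta_bar h (U : T) : R :=
  \sum_(i < n) (h (E i) (F (E i)) U - h (F (E i)) (E i) U).

Definition zero_VVV h : Prop := forall X Y Z,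
  xi_perp X -> xi_perp Y -> xi_perp Z -> h X Y Z = 0.

Definition zero_VVxi h : Prop := forall X Y,
  xi_perp X -> xi_perp Y -> h X Y xi = 0.

Definition zero_xiVxi h : Prop := forall X, xi_perp X -> h xi X xi = 0.

Definition zero_xiVV h : Prop := forall X Y,
  xi_perp X -> xi_perp Y -> h xi X Y = 0.

Definition T1 : set ternary_fun := [set h | [/\ T_space h,
  forall X Y Z, xi_perp X -> xi_perp Y -> xi_perp Z -> h X Y Z = - h Y X Z,
  zero_VVxi h, zero_xiVxi h & zero_xiVV h]].

Definition T2 : set ternary_fun := [set h | [/\ T_space h,
  forall X Y Z, xi_perp X -> xi_perp Y -> xi_perp Z ->
    h X Y Z + h Y Z X + h Z X Y = 0,
  zero_VVxi h, zero_xiVxi h & zero_xiVV h]].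

Definition T3 : set ternary_fun := [set h | [/\ T_space h,
  forall X Y Z, xi_perp X -> xi_perp Y -> xi_perp Z ->
    h X Y Z - h (F X) (F Y) Z = beta h Z /\ beta h Z = 0,
  zero_VVxi h, zero_xiVxi h & zero_xiVV h]].

Definition T4 : set ternary_fun := [set h | [/\ T_space h,
  forall X Y Z, xi_perp X -> xi_perp Y -> xi_perp Z ->
    h X Y Z = (2 * (n%:R - 1))^-1 *
      ('[X, Y] * beta h Z - '[X, Z] * beta h Y
       - '[X, F Y] * beta h (F Z) + '[X, F Z] * beta h (F Y)),
  zero_VVxi h, zero_xiVxi h & zero_xiVV h]].

Definition T5 : set ternary_fun := [set h | [/\ T_space h,
  forall X Y, xi_perp X -> xi_perp Y ->
    h X Y xi = - h Y X xi /\ h (F X) (F Y) xi = h X Y xi,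
  beta_bar h xi = 0
  & [/\ zero_VVV h, zero_xiVxi h & zero_xiVV h]]].

Definition T6 : set ternary_fun := [set h | [/\ T_space h,
  forall X Y, xi_perp X -> xi_perp Y ->
    h X Y xi = - h Y X xi /\ h (F X) (F Y) xi = - h X Y xi,
  zero_VVV h, zero_xiVxi h & zero_xiVV h]].

Definition T7 : set ternary_fun := [set h | [/\ T_space h,
  forall X Y, xi_perp X -> xi_perp Y ->
    h X Y xi = - (2 * n%:R)^-1 * '[X, F Y] * beta_bar h xi,
  zero_VVV h, zero_xiVxi h & zero_xiVV h]].

Definition T8 : set ternary_fun := [set h | [/\ T_space h,
  forall X Y, xi_perp X -> xi_perp Y ->
    h X Y xi = h Y X xi /\ h (F X) (F Y) xi = h X Y xi,
  beta h xi = 0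
  & [/\ zero_VVV h, zero_xiVxi h & zero_xiVV h]]].

Definition T9 : set ternary_fun := [set h | [/\ T_space h,
  forall X Y, xi_perp X -> xi_perp Y ->
    h X Y xi = h Y X xi /\ h (F X) (F Y) xi = - h X Y xi,
  zero_VVV h, zero_xiVxi h & zero_xiVV h]].

Definition T10 : set ternary_fun := [set h | [/\ T_space h,
  forall X Y, xi_perp X -> xi_perp Y ->
    h X Y xi = (2 * n%:R)^-1 * '[X, Y] * beta h xi,
  zero_VVV h, zero_xiVxi h & zero_xiVV h]].

Definition T11 : set ternary_fun := [set h | [/\ T_space h,
  zero_VVV h, zero_VVxi h & zero_xiVV h]].

Definition T12 : set ternary_fun := [set h | [/\ T_space h,
  forall X Y, xi_perp X -> xi_perp Y ->
    h xi X Y = - h xi Y X /\ - h xi Y X = - h xi (F X) (F Y),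
  zero_VVV h, zero_VVxi h & zero_xiVxi h]].

Definition B a : ternary_fun := fun X Y Z =>
  2^-1 * eta Y * a X xi (F Z) - eta Z * a X xi (F Y) + 2^-1 * a X Y (F Z).

End AlmostContactMetric.

(* Main.v *)
Require Import Defs.
From mathcomp Require Import all_boot all_order all_algebra.
From mathcomp Require Import all_classical reals.
From mathcomp Require Import ring lra.

(** Write T = V (+) R xi, where V is the orthogonal of xi. The defining
    identities of the two spaces say the same thing: a trilinear form, skew in
    its last two arguments, that changes sign when F is applied to both of
    these arguments in V ([C_spaceE]). So B is an endomorphism of a single
    space. A form skew in its last two arguments is determined by its four
    blocks VVV, VV xi, xi VV and xi V xi ([block_expand]), and B preserves this
    block decomposition: for Y and Z in V,
      (B a)(X, Y, Z) = a(X, Y, F Z) / 2,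
      (B a)(X, Y, xi) = a(X, F Y, xi) = - (nabla_X eta) Y,
    as [B_horizontal], [B_xi] and [nabla_etaE] state. Since F ^ 2 = - 1 on V,
    both formulas can be solved for a, which yields the inverse [B_inv].

    By bijectivity ([image_B_class]), B maps C_i onto T_j as soon as a form a
    of the space is in C_i exactly when B a is in T_j. Each block of B a
    vanishes if and only if the same block of a does, so every such equivalence
    amounts to showing that the identity defining C_i kills all blocks but one
    and, on the remaining block, translates into the identity defining T_j. The
    traces translate by [delta_PhiE] and [delta_etaE].

    Two cases need more than the block formulas. For C_2, the cyclic identity
    must survive replacing Z by F Z; it does because it forces the behaviour of
    F on the first argument too ([cyclic_F]). The classes C_7, ..., C_10 differ
    only by two signs, and [nabla_eta_class] treats them at once: with the
    signs s and t in the formula for a, the bilinear form (nabla eta) on V is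
    symmetric or skew according to - s t, and invariant or anti-invariant under
    F according to t. *)

Set Implicit Arguments.
Unset Strict Implicit.
Unset Printing Implicit Defensive.

Import Order.TTheory GRing.Theory Num.Theory.
Local Open Scope classical_set_scope.
Local Open Scope ring_scope.

(** * Trilinear forms *)

Section Trilinear.
Variables (R : realType) (T : vectType R).
Implicit Types (a b : ternary_fun T) (X Y Z U V : T).

Section Slots.
Variables (a : ternary_fun T) (ta : trilinear a).

Lemma triD1 X U Y Z : a (X + U) Y Z = a X Y Z + a U Y Z.
Proof. by case: ta => + _ _ => /(_ Y Z 1 X U); rewrite scale1r mul1r. Qed.

Lemma triD2 X Y U Z : a X (Y + U) Z = a X Y Z + a X U Z.
Proof. by case: ta => _ + _ => /(_ X Z 1 Y U); rewrite scale1r mul1r. Qed.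

Lemma triD3 X Y Z U : a X Y (Z + U) = a X Y Z + a X Y U.
Proof. by case: ta => _ _ /(_ X Y 1 Z U); rewrite scale1r mul1r. Qed.

Lemma tri01 Y Z : a 0 Y Z = 0.
Proof. by apply: (addrI (a 0 Y Z)); rewrite -triD1 !addr0. Qed.

Lemma tri02 X Z : a X 0 Z = 0.
Proof. by apply: (addrI (a X 0 Z)); rewrite -triD2 !addr0. Qed.

Lemma tri03 X Y : a X Y 0 = 0.
Proof. by apply: (addrI (a X Y 0)); rewrite -triD3 !addr0. Qed.

Lemma triZ1 c X Y Z : a (c *: X) Y Z = c * a X Y Z.
Proof. by case: ta => + _ _ => /(_ Y Z c X 0); rewrite addr0 tri01 addr0. Qed.

Lemma triZ2 X c Y Z : a X (c *: Y) Z = c * a X Y Z.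
Proof. by case: ta => _ + _ => /(_ X Z c Y 0); rewrite addr0 tri02 addr0. Qed.

Lemma triZ3 X Y c Z : a X Y (c *: Z) = c * a X Y Z.
Proof. by case: ta => _ _ /(_ X Y c Z 0); rewrite addr0 tri03 addr0. Qed.

Lemma triN2 X Y Z : a X (- Y) Z = - a X Y Z.
Proof. by rewrite -[- Y]scaleN1r triZ2 mulN1r. Qed.

Lemma triN3 X Y Z : a X Y (- Z) = - a X Y Z.
Proof. by rewrite -[- Z]scaleN1r triZ3 mulN1r. Qed.

End Slots.
End Trilinear.

(** * The splitting of T into the orthogonal of xi and the line of xi *)

Section AlmostContact.
Variables (R : realType) (n : nat) (T : vectType R).
Variables (dot : {dot T for idfun}) (xi : T) (F : {linear T -> T}).
Hypothesis acm : almost_contact_metric dot xi F.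
Implicit Types (a b h : ternary_fun T) (X Y Z U : T).

Local Notation "''[' X , Y ]" := (dot X Y).
Local Notation eta := (eta dot xi).
Local Notation horizontal := (xi_perp dot xi).
Local Notation B := (B dot xi F).
Local Notation T_space := (T_space dot xi F).
Local Notation C_space := (C_space dot xi F).

Lemma dotC X Y : '[X, Y] = '[Y, X].
Proof. by rewrite (hermC dot X Y) expr0 mul1r. Qed.

Lemma eta_linear : scalar eta.
Proof. by move=> c u v; rewrite /eta linearDl linearZl_LR. Qed.

Definition perp X := X - eta X *: xi.

Lemma perp_decomp X : X = perp X + eta X *: xi.
Proof. by rewrite subrK. Qed.

Lemma eta_xi : eta xi = 1.
Proof. exact: acm_xi_unit acm. Qed.

Lemma perp_horizontal X : horizontal (perp X).
Proof.
rewrite /xi_perp /perp /= linearBl linearZl_LR /=.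
by rewrite (acm_xi_unit acm) mulr1 subrr.
Qed.

Lemma eta_horizontal X : horizontal X -> eta X = 0.
Proof. by []. Qed.

Lemma perp_id X : horizontal X -> perp X = X.
Proof. by move=> /eta_horizontal hX; rewrite /perp hX scale0r subr0. Qed.

Lemma F_perp X : F (perp X) = F X.
Proof. by rewrite linearB linearZ /= (acm_F_xi acm) scaler0 subr0. Qed.

Lemma F_horizontal X : horizontal (F X).
Proof. by rewrite -F_perp; apply/(acm_F_perp acm)/perp_horizontal. Qed.

Lemma eta_F X : eta (F X) = 0.
Proof. exact: F_horizontal. Qed.

Lemma FF X : F (F X) = - perp X.
Proof. by rewrite -(F_perp X) (acm_F_sqr acm)//; exact: perp_horizontal. Qed.

Lemma FF_horizontal X : horizontal X -> F (F X) = - X.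
Proof. exact: acm_F_sqr. Qed.

Lemma dot_perpl X Y : horizontal Y -> '[perp X, Y] = '[X, Y].
Proof.
move=> hY; rewrite /perp linearBl linearZl_LR /= [X in _ - _ * X]dotC.
by rewrite (eta_horizontal hY : '[Y, xi] = 0) mulr0 subr0.
Qed.

Lemma dot_perp X Y : '[perp X, perp Y] = '[X, Y] - eta X * eta Y.
Proof.
rewrite dot_perpl; last exact: perp_horizontal.
by rewrite /perp dotC linearBl linearZl_LR /= !(dotC _ X) (mulrC (eta X)).
Qed.

Lemma dot_FF X Y : '[F X, F Y] = '[perp X, perp Y].
Proof.
by rewrite -(F_perp X) -(F_perp Y) (acm_F_isom acm)//; exact: perp_horizontal.
Qed.

Lemma Phi_xi X : Phi dot F xi X = 0.
Proof. by rewrite /Phi dotC; exact: eta_F. Qed.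

(** * Block decomposition of the tensors *)

Section Tensor.
Variables (a : ternary_fun T) (Ta : T_space a).

Lemma T_tri : trilinear a. Proof. by case: Ta. Qed.

Lemma T_skew X Y Z : a X Y Z = - a X Z Y.
Proof. by case: Ta => _ + _; apply. Qed.

Lemma T_FF X Y Z : horizontal Y -> horizontal Z ->
  a X (F Y) (F Z) = - a X Y Z.
Proof.
by case: Ta => _ _ aF hY hZ; rewrite (aF _ _ _ hY hZ) opprK.
Qed.

(** F is its own inverse up to sign on V, so being anti-invariant under F in the
    last two arguments means that F can be moved from one to the other. *)
Lemma T_Fmove X Y Z : horizontal Y -> horizontal Z ->
  a X (F Y) Z = a X Y (F Z).
Proof.
move=> hY hZ; rewrite -[in LHS](opprK Z) -(FF_horizontal hZ).
by rewrite (triN3 T_tri) T_FF ?opprK//; exact: F_horizontal.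
Qed.

Lemma T_diag X Y : a X Y Y = 0.
Proof. by have := T_skew X Y Y; lra. Qed.

Lemma split_arg1 X Y Z : a X Y Z = a (perp X) Y Z + eta X * a xi Y Z.
Proof. by rewrite {1}(perp_decomp X) (triD1 T_tri) (triZ1 T_tri). Qed.

Lemma split_arg2 X Y Z : a X Y Z = a X (perp Y) Z + eta Y * a X xi Z.
Proof. by rewrite {1}(perp_decomp Y) (triD2 T_tri) (triZ2 T_tri). Qed.

Lemma split_arg3 X Y Z : a X Y Z = a X Y (perp Z) + eta Z * a X Y xi.
Proof. by rewrite {1}(perp_decomp Z) (triD3 T_tri) (triZ3 T_tri). Qed.

Lemma perp_xi X Y : a X (perp Y) xi = a X Y xi.
Proof. by rewrite [RHS]split_arg2 T_diag mulr0 addr0. Qed.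

Lemma block_expand23 X Y Z :
  a X Y Z = a X (perp Y) (perp Z) + eta Z * a X (perp Y) xi
            - eta Y * a X (perp Z) xi.
Proof.
rewrite {1}split_arg2 {1}split_arg3 (T_skew X xi Z) perp_xi.
rewrite -(perp_xi X Z); ring.
Qed.

Lemma block_expand X Y Z :
  a X Y Z = a (perp X) (perp Y) (perp Z) + eta Z * a (perp X) (perp Y) xi
    - eta Y * a (perp X) (perp Z) xi
    + eta X * (a xi (perp Y) (perp Z) + eta Z * a xi (perp Y) xi
               - eta Y * a xi (perp Z) xi).
Proof. by rewrite {1}split_arg1 -!block_expand23. Qed.

End Tensor.

Lemma T_ext a b : T_space a -> T_space b ->
  (forall X Y Z, horizontal Y -> horizontal Z -> a X Y Z = b X Y Z) ->
  (forall X Y, horizontal Y -> a X Y xi = b X Y xi) -> a = b.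
Proof.
move=> Ta Tb ab ab_xi; apply/funext => X; apply/funext => Y; apply/funext => Z.
rewrite (block_expand23 Ta) (block_expand23 Tb).
by rewrite ab ?ab_xi//; exact: perp_horizontal.
Qed.

(** Both identities agree when Y and Z are in V; when one of them is xi, the
    identity of [C_space] holds for every skew form because F xi = 0. *)
Lemma C_spaceE : C_space = T_space.
Proof.
apply/seteqP; split=> a.
  move=> [ta ca]; split=> // [X Y Z|X Y Z hY hZ]; first by case: (ca X Y Z).
  case: (ca X Y Z) => -> ->.
  by rewrite (eta_horizontal hY) (eta_horizontal hZ) !mul0r !addr0.
move=> Ta; split=> [|X Y Z]; first exact: T_tri Ta.
split; first exact: T_skew Ta _ _ _.
rewrite -(T_skew Ta) -(F_perp Y) -(F_perp Z).
rewrite (T_FF Ta); [|exact: perp_horizontal..].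
rewrite opprK {1}(block_expand23 Ta) (T_skew Ta X xi) !(perp_xi Ta); ring.
Qed.

(** * B as a linear automorphism *)

Lemma T_space_submod : submod_closed (mem T_space).
Proof.
split=> [|c a b]; rewrite !inE.
  have z X Y Z : (0 : ternary_fun T) X Y Z = 0 by [].
  split=> [|X Y Z|X Y Z _ _]; rewrite ?z ?oppr0//.
  by split=> [Y Z|X Z|X Y] k u v; rewrite !z; ring.
move=> Ta Tb; have ta := T_tri Ta; have tb := T_tri Tb.
have z X Y Z : (c *: a + b) X Y Z = c * a X Y Z + b X Y Z by [].
split=> [|X Y Z|X Y Z hY hZ]; rewrite ?z.
- split=> [Y Z|X Z|X Y] k u v; rewrite !z.
  + by rewrite !(triD1 ta, triD1 tb, triZ1 ta, triZ1 tb); ring.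
  + by rewrite !(triD2 ta, triD2 tb, triZ2 ta, triZ2 tb); ring.
  + by rewrite !(triD3 ta, triD3 tb, triZ3 ta, triZ3 tb); ring.
- by rewrite (T_skew Ta X Y) (T_skew Tb X Y); ring.
- by rewrite (T_FF Ta)// (T_FF Tb)//; ring.
Qed.

Lemma B_linear : linear B.
Proof.
move=> c a b; apply/funext => X; apply/funext => Y; apply/funext => Z.
have z U V W : (c *: a + b) U V W = c * a U V W + b U V W by [].
have z' U V W : (c *: B a + B b) U V W = c * B a U V W + B b U V W by [].
by rewrite z' /Defs.B !z; ring.
Qed.

(** For Y, Z in V only the first term survives; it inverts the VV part of B. For
    Y in V and Z = xi only the last term survives; it inverts the V xi part. The
    middle term restores the skew symmetry. *)
Definition B_inv h : ternary_fun T := fun X Y Z =>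
  - 2 * h X Y (F Z) - eta Y * h X (F Z) xi - eta Z * h X (F Y) xi.

Section BlockFormulas.
Variables (a : ternary_fun T) (Ta : T_space a).

Lemma B_horizontal X Y Z : horizontal Y -> horizontal Z ->
  B a X Y Z = 2^-1 * a X Y (F Z).
Proof.
move=> hY hZ; rewrite /Defs.B (eta_horizontal hY) (eta_horizontal hZ).
by rewrite mulr0 !mul0r subrr add0r.
Qed.

Lemma B_xi X Y : B a X Y xi = a X (F Y) xi.
Proof.
rewrite /Defs.B (acm_F_xi acm) eta_xi !(tri03 (T_tri Ta)).
by rewrite (T_skew Ta X (F Y)) !mulr0 mul1r add0r addr0.
Qed.

Lemma horizontal_of_B X Y Z : horizontal Y -> horizontal Z ->
  a X Y Z = - 2 * B a X Y (F Z).
Proof.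
move=> hY hZ; rewrite B_horizontal//; last exact: F_horizontal.
rewrite FF_horizontal// (triN3 (T_tri Ta)); lra.
Qed.

Lemma xi_of_B X Y : a X Y xi = - B a X (F Y) xi.
Proof. by rewrite B_xi FF (triN2 (T_tri Ta)) opprK (perp_xi Ta). Qed.

Lemma nabla_etaE X Y : nabla_eta xi F a X Y = - B a X Y xi.
Proof. by rewrite B_xi /nabla_eta (T_skew Ta). Qed.

Lemma B_T_space : T_space (B a).
Proof.
have ta := T_tri Ta.
split=> [|X Y Z|X Y Z hY hZ].
- split=> [Y Z|X Z|X Y] c u v; rewrite /Defs.B.
  + by rewrite !(triD1 ta, triZ1 ta); ring.
  + by rewrite eta_linear linearP !(triD2 ta, triD3 ta,
      triZ2 ta, triZ3 ta); ring.
  + by rewrite eta_linear linearP !(triD2 ta, triD3 ta,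
      triZ2 ta, triZ3 ta); ring.
- have aF : a X (perp Y) (F Z) = - a X (perp Z) (F Y).
    rewrite -(F_perp Z) -(T_Fmove Ta); [|exact: perp_horizontal..].
    by rewrite F_perp (T_skew Ta).
  rewrite /Defs.B (split_arg2 Ta X Y (F Z)) (split_arg2 Ta X Z (F Y)) aF; lra.
- rewrite !B_horizontal//; try exact: F_horizontal.
  rewrite (T_FF Ta)//; try exact: F_horizontal; ring.
Qed.

End BlockFormulas.

Lemma B_inv_T_space h : T_space h -> T_space (B_inv h).
Proof.
move=> Th; have th := T_tri Th.
split=> [|X Y Z|X Y Z hY hZ].
- split=> [Y Z|X Z|X Y] c u v; rewrite /B_inv.
  + by rewrite !(triD1 th, triZ1 th); ring.
  + by rewrite eta_linear linearP !(triD2 th, triZ2 th); ring.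
  + by rewrite eta_linear linearP !(triD2 th, triD3 th,
      triZ2 th, triZ3 th); ring.
- have hF : h X (perp Y) (F Z) = - h X (perp Z) (F Y).
    rewrite -(F_perp Z) -(T_Fmove Th); [|exact: perp_horizontal..].
    by rewrite F_perp (T_skew Th).
  rewrite /B_inv (split_arg2 Th X Y (F Z)) (split_arg2 Th X Z (F Y)) hF.
  rewrite !(T_skew Th X xi (F _)); ring.
- rewrite /B_inv !eta_F (eta_horizontal hY) (eta_horizontal hZ).
  rewrite (T_FF Th)//; last exact: F_horizontal.
  ring.
Qed.

Lemma B_B_inv h : T_space h -> B (B_inv h) = h.
Proof.
move=> Th; have Gh := B_inv_T_space Th; have th := T_tri Th.
apply: T_ext => // [|X Y Z hY hZ|X Y hY]; first exact: B_T_space.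
  rewrite B_horizontal// /B_inv (eta_horizontal hY) eta_F FF_horizontal//.
  rewrite (triN3 th); lra.
rewrite B_xi// /B_inv !eta_F eta_xi (acm_F_xi acm) FF_horizontal//.
rewrite (triN2 th) (tri03 th); ring.
Qed.

Lemma B_inv_B a : T_space a -> B_inv (B a) = a.
Proof.
move=> Ta; have Tb := B_T_space Ta; have tb := T_tri Tb.
apply: T_ext => // [|X Y Z hY hZ|X Y hY]; first exact: B_inv_T_space.
  rewrite /B_inv (eta_horizontal hY) (eta_horizontal hZ).
  rewrite (horizontal_of_B Ta)//; ring.
rewrite /B_inv eta_xi (acm_F_xi acm) (eta_horizontal hY) (xi_of_B Ta).
rewrite !(tri03 tb); ring.
Qed.

Lemma B_bij : set_bij C_space T_space B.
Proof.
rewrite C_spaceE; split=> [a|a b|h] /=.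
- exact: B_T_space.
- by rewrite !inE => Ta Tb eqB; rewrite -(B_inv_B Ta) eqB B_inv_B.
- by move=> Th; exists (B_inv h); [exact: B_inv_T_space|exact: B_B_inv].
Qed.

(** * Transport of classes along B *)

Lemma image_B_class (Ci Tj : set (ternary_fun T)) :
  Ci `<=` C_space -> Tj `<=` T_space ->
  (forall a, T_space a -> Ci a <-> Tj (B a)) -> B @` Ci = Tj.
Proof.
move=> subC subT CT; apply/seteqP; split=> [_ [a Ca <-]|h Th].
  by apply/CT => //; rewrite -C_spaceE; exact: subC.
have Th' := subT _ Th.
exists (B_inv h); rewrite ?B_B_inv//.
by apply/CT; [exact: B_inv_T_space|rewrite B_B_inv].
Qed.

Section Blocks.
Variables (a : ternary_fun T) (Ta : T_space a).

Lemma zero_VVV_B : zero_VVV dot xi (B a) <-> zero_VVV dot xi a.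
Proof.
split=> z X Y Z hX hY hZ.
  by rewrite (horizontal_of_B Ta)// z ?mulr0//; exact: F_horizontal.
by rewrite B_horizontal// z ?mulr0//; exact: F_horizontal.
Qed.

Lemma zero_xiVV_B : zero_xiVV dot xi (B a) <-> zero_xiVV dot xi a.
Proof.
split=> z Y Z hY hZ.
  by rewrite (horizontal_of_B Ta)// z ?mulr0//; exact: F_horizontal.
by rewrite B_horizontal// z ?mulr0//; exact: F_horizontal.
Qed.

Lemma zero_VVxi_B : zero_VVxi dot xi (B a) <-> zero_VVxi dot xi a.
Proof.
split=> z X Y hX hY.
  by rewrite (xi_of_B Ta)// z ?oppr0//; exact: F_horizontal.
by rewrite B_xi// z//; exact: F_horizontal.
Qed.

Lemma zero_xiVxi_B : zero_xiVxi dot xi (B a) <-> zero_xiVxi dot xi a.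
Proof.
split=> z Y hY.
  by rewrite (xi_of_B Ta)// z ?oppr0//; exact: F_horizontal.
by rewrite B_xi// z//; exact: F_horizontal.
Qed.

(** Up to the isomorphism F of V, the covariant derivative of eta is the part of
    the tensor that contains xi among its last two arguments. *)
Lemma nabla_eta_eq0 : (forall X Y, nabla_eta xi F a X Y = 0) <->
  zero_VVxi dot xi a /\ zero_xiVxi dot xi a.
Proof.
split=> [N0|[z1 z2] X Y].
  have z X Y : a X Y xi = 0.
    by have := N0 X (F Y); rewrite (nabla_etaE Ta) (xi_of_B Ta).
  by split=> X *; exact: z.
rewrite (nabla_etaE Ta) (B_xi Ta) (split_arg1 Ta) z1 ?z2 ?mulr0 ?addr0 ?oppr0//.
all: by [exact: F_horizontal|exact: perp_horizontal].
Qed.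

End Blocks.

Lemma only_VVV a : T_space a ->
  zero_VVxi dot xi a -> zero_xiVxi dot xi a -> zero_xiVV dot xi a ->
  forall X Y Z, a X Y Z = a (perp X) (perp Y) (perp Z).
Proof.
move=> Ta zVx xVx xVV X Y Z; rewrite {1}(block_expand Ta).
have hp := perp_horizontal.
rewrite !xVx ?zVx ?xVV//; ring.
Qed.

Lemma only_VVxi a : T_space a ->
  zero_VVV dot xi a -> zero_xiVxi dot xi a -> zero_xiVV dot xi a ->
  forall X Y Z, a X Y Z =
    eta Z * a (perp X) (perp Y) xi - eta Y * a (perp X) (perp Z) xi.
Proof.
move=> Ta z0 xVx xVV X Y Z; rewrite {1}(block_expand Ta).
have hp := perp_horizontal.
rewrite z0 ?xVx ?xVV//; ring.
Qed.

(** * Classes concentrated on the block VVV *)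

Lemma alternating_skew a : trilinear a -> (forall X Y, a X X Y = 0) ->
  forall X Y Z, a X Y Z = - a Y X Z.
Proof.
move=> ta alt X Y Z; have := alt (X + Y) Z.
by rewrite (triD1 ta) !(triD2 ta) !alt; lra.
Qed.

Lemma C1_iff_T1 a : T_space a -> C1 dot xi F a <-> T1 dot xi F (B a).
Proof.
move=> Ta; have ta := T_tri Ta; have hp := perp_horizontal.
rewrite /C1 /T1 /= C_spaceE; split.
  move=> [_ alt /(nabla_eta_eq0 Ta)[z1 z2]].
  have sk := alternating_skew ta alt.
  split; [exact: B_T_space| |exact/zero_VVxi_B|exact/zero_xiVxi_B|].
    by move=> X Y Z hX hY hZ; rewrite !B_horizontal// sk; ring.
  apply/zero_xiVV_B => // Y Z hY hZ.
  by rewrite sk (T_skew Ta) z1// !oppr0.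
move=> [_ sk /(zero_VVxi_B Ta) z1 /(zero_xiVxi_B Ta) z2 /(zero_xiVV_B Ta) z3].
split=> //; last exact/(nabla_eta_eq0 Ta).
move=> X Y; rewrite (only_VVV Ta)// (horizontal_of_B Ta)//.
have := sk _ _ _ (hp X) (hp X) (F_horizontal (perp Y)); lra.
Qed.

(** This is the algebraic fact that almost Kaehler structures are quasi-Kaehler.
    Let p = a(X, Y, Z), q = a(Y, Z, X), r = a(Z, X, Y), p' = a(F X, F Y, Z),
    q' = a(F Y, F Z, X) and r' = a(F Z, F X, Y). The cyclic identity at
    (X, Y, Z) and at the three triples obtained by applying F to two of the
    arguments reads p + q + r = 0, p' + q' = r, q' + r' = p and r' + p' = q,
    whence p' = - p. So F moves freely between all three arguments, and the
    cyclic sum in the conclusion is the cyclic sum of a at (X, Y, F Z). *)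
Lemma cyclic_F a : T_space a ->
  (forall X Y Z, horizontal X -> horizontal Y -> horizontal Z ->
     a X Y Z + a Y Z X + a Z X Y = 0) ->
  forall X Y Z, horizontal X -> horizontal Y -> horizontal Z ->
     a X Y (F Z) + a Y Z (F X) + a Z X (F Y) = 0.
Proof.
move=> Ta cyc; have hF := F_horizontal; have ta := T_tri Ta.
have quasi X Y Z : horizontal X -> horizontal Y -> horizontal Z ->
    a (F X) (F Y) Z = - a X Y Z.
  move=> hX hY hZ.
  have := cyc X Y Z hX hY hZ.
  have := cyc (F X) (F Y) Z (hF _) (hF _) hZ.
  have := cyc X (F Y) (F Z) hX (hF _) (hF _).
  have := cyc (F X) Y (F Z) (hF _) hY (hF _).
  rewrite (T_FF Ta X hY hZ) (T_FF Ta Y hZ hX) (T_FF Ta Z hX hY).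
  rewrite (T_Fmove Ta (F Y) hZ hX) (T_Fmove Ta (F X) hY hZ).
  rewrite (T_Fmove Ta (F Z) hX hY); lra.
have F1 X Y Z : horizontal X -> horizontal Y -> horizontal Z ->
    a (F X) Y Z = a X Y (F Z).
  move=> hX hY hZ.
  have := quasi X (F Y) Z hX (hF _) hZ.
  by rewrite FF_horizontal// (triN2 ta) (T_Fmove Ta)//; lra.
move=> X Y Z hX hY hZ.
have := cyc X Y (F Z) hX hY (hF _).
by rewrite (T_Fmove Ta Y hZ hX) F1.
Qed.

Lemma C2_iff_T2 a : T_space a -> C2 dot xi F a <-> T2 dot xi F (B a).
Proof.
move=> Ta; have hp := perp_horizontal; have hF := F_horizontal.
rewrite /C2 /T2 /= C_spaceE; split.
  move=> [_ cyc /(nabla_eta_eq0 Ta)[z1 z2]].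
  split; [exact: B_T_space| |exact/zero_VVxi_B|exact/zero_xiVxi_B|].
    move=> X Y Z hX hY hZ; rewrite !B_horizontal//.
    have := cyclic_F Ta (fun X Y Z _ _ _ => cyc X Y Z) hX hY hZ; lra.
  apply/zero_xiVV_B => // Y Z hY hZ.
  by have := cyc xi Y Z; rewrite (T_skew Ta Z xi) !z1// oppr0 !addr0.
move=> [Tb cyc /(zero_VVxi_B Ta) z1 /(zero_xiVxi_B Ta) z2 /(zero_xiVV_B Ta) z3].
split=> //; last exact/(nabla_eta_eq0 Ta).
move=> X Y Z; have az := only_VVV Ta z1 z2 z3.
rewrite (az X) (az Y) (az Z).
rewrite !(horizontal_of_B Ta)//.
have := cyclic_F Tb cyc (hp X) (hp Y) (hp Z); lra.
Qed.

(** * Traces *)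

Section Traces.
Variable E : 'I_n -> T.
Hypothesis hE : forall i, horizontal (E i).

Lemma beta_opp h U : T_space h -> beta F E h (- U) = - beta F E h U.
Proof.
move=> Th; rewrite /beta -sumrN; apply: eq_bigr => i _.
by rewrite !(triN3 (T_tri Th)) opprD.
Qed.

Lemma delta_Phi0 a : T_space a -> delta_Phi xi F E a 0 = 0.
Proof.
move=> Ta; rewrite /delta_Phi (tri03 (T_tri Ta)) subr0 big1 ?oppr0// => i _.
by rewrite !(tri03 (T_tri Ta)) addr0.
Qed.

(** Expanding U along V and xi, the two parts of a(E, E, U) are, by the block
    formulas and up to constant factors, (B a)(E, E, F U) and (B a)(E, F E, xi):
    hence one trace of each of the two kinds. *)
Lemma delta_PhiE a U : T_space a ->
  delta_Phi xi F E a U = 2 * beta F E (B a) (F U)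
    + eta U * beta_bar F E (B a) xi - a xi xi U.
Proof.
move=> Ta; rewrite /delta_Phi; congr (_ - _).
rewrite /beta /beta_bar !mulr_sumr -sumrN -big_split; apply: eq_bigr => i _ /=.
have aE X Y : horizontal Y ->
    a X Y U = - 2 * B a X Y (F U) - eta U * B a X (F Y) xi.
  move=> hY; rewrite (split_arg3 Ta) (horizontal_of_B Ta)//; last first.
    exact: perp_horizontal.
  by rewrite F_perp (xi_of_B Ta); ring.
rewrite !aE//; last exact: F_horizontal.
rewrite FF_horizontal// (triN2 (T_tri (B_T_space Ta))); ring.
Qed.

Lemma delta_etaE a : T_space a -> delta_eta xi F E a = beta F E (B a) xi.
Proof.
move=> Ta; rewrite /delta_eta /beta -sumrN; apply: eq_bigr => i _.
by rewrite !(nabla_etaE Ta); ring.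
Qed.

Lemma beta_bar_xi0 h : zero_VVxi dot xi h -> beta_bar F E h xi = 0.
Proof.
move=> z; rewrite /beta_bar big1// => i _.
by rewrite !z ?subrr//; exact: F_horizontal.
Qed.

Lemma beta_VVV0 h U : zero_VVV dot xi h -> horizontal U -> beta F E h U = 0.
Proof.
move=> z hU; rewrite /beta big1// => i _.
by rewrite !z ?addr0//; exact: F_horizontal.
Qed.

Lemma delta_Phi_horizontal a : T_space a ->
  zero_VVxi dot xi a -> zero_xiVxi dot xi a ->
  forall U, delta_Phi xi F E a U = 2 * beta F E (B a) (F U).
Proof.
move=> Ta z1 z2 U; rewrite delta_PhiE//.
rewrite beta_bar_xi0; last exact/zero_VVxi_B.
rewrite (T_skew Ta) -(perp_xi Ta) z2; last exact: perp_horizontal.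
by ring.
Qed.

Lemma delta_Phi_vertical a : T_space a ->
  zero_VVV dot xi a -> zero_xiVxi dot xi a ->
  forall U, delta_Phi xi F E a U = eta U * beta_bar F E (B a) xi.
Proof.
move=> Ta z1 z2 U; rewrite delta_PhiE// beta_VVV0; last exact: F_horizontal.
  rewrite (T_skew Ta) -(perp_xi Ta) z2; last exact: perp_horizontal.
  by ring.
exact/zero_VVV_B.
Qed.

(** * The classes C_3 and C_4 *)

Lemma C3_iff_T3 a : T_space a -> C3 dot xi F E a <-> T3 dot xi F E (B a).
Proof.
move=> Ta; have ta := T_tri Ta.
have hp := perp_horizontal; have hF := F_horizontal.
have Tb := B_T_space Ta.
rewrite /C3 /T3 /= C_spaceE; split.
  move=> [_ quasi d0].
  have zx Y Z : a xi Y Z = 0.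
    by have := quasi xi Y Z; rewrite (acm_F_xi acm) (tri01 ta) subr0.
  have zxi X Y : a X Y xi = 0.
    have := quasi X xi Y; rewrite (acm_F_xi acm) (tri02 ta) subr0 (T_skew Ta).
    by move=> /eqP; rewrite oppr_eq0 => /eqP.
  have z1 : zero_VVxi dot xi a by move=> *; exact: zxi.
  have z2 : zero_xiVxi dot xi a by move=> *; exact: zxi.
  split=> //; [|exact/zero_VVxi_B|exact/zero_xiVxi_B|].
    move=> X Y Z hX hY hZ.
    have b0 : beta F E (B a) Z = 0.
      have := d0 (F Z).
      by rewrite delta_Phi_horizontal// FF_horizontal// beta_opp//; lra.
    rewrite b0; split=> //; rewrite !B_horizontal//.
    by have := quasi X Y (F Z); lra.
  by apply/zero_xiVV_B => // *; exact: zx.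
move=> [_ quasi].
move=> /(zero_VVxi_B Ta) z1 /(zero_xiVxi_B Ta) z2 /(zero_xiVV_B Ta) z3.
split=> // [X Y Z|U].
  have az := only_VVV Ta z1 z2 z3.
  rewrite az (az (F X)) !(perp_id (hF _)).
  rewrite !(horizontal_of_B Ta)//.
  have [] := quasi _ _ _ (hp X) (hp Y) (hF Z).
  by rewrite !F_perp; lra.
rewrite delta_Phi_horizontal//.
by have [_ ->] := quasi _ _ _ (hF U) (hF U) (hF U); rewrite mulr0.
Qed.

Lemma C4_iff_T4 a : T_space a -> C4 dot xi F E a <-> T4 dot xi F E (B a).
Proof.
move=> Ta.
have hp := perp_horizontal; have hF := F_horizontal.
have Tb := B_T_space Ta.
rewrite /C4 /T4 /= C_spaceE; set c := (2 * (n%:R - 1))^-1; split.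
  move=> [_ aE d0].
  have zx Y Z : a xi Y Z = 0.
    rewrite aE (acm_F_xi acm) !linear0l !Phi_xi; ring.
  have zxi X Y : a X Y xi = 0.
    rewrite aE /Phi (acm_F_xi acm) !linear0r d0 delta_Phi0//; ring.
  have z1 : zero_VVxi dot xi a by move=> *; exact: zxi.
  have z2 : zero_xiVxi dot xi a by move=> *; exact: zxi.
  split=> //; [|exact/zero_VVxi_B|exact/zero_xiVxi_B|].
    move=> X Y Z hX hY hZ.
    rewrite B_horizontal// aE !delta_Phi_horizontal// /Phi.
    rewrite !dot_FF !(perp_id hX) !(perp_id hY) !(perp_id (hF _)).
    rewrite !(FF_horizontal (hF _)) !FF_horizontal// !beta_opp// !linearNr.
    by rewrite /=; lra.
  by apply/zero_xiVV_B => // *; exact: zx.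
move=> [_ bE /(zero_VVxi_B Ta) z1 /(zero_xiVxi_B Ta) z2 /(zero_xiVV_B Ta) z3].
split=> // [X Y Z|]; last first.
  rewrite delta_Phi_horizontal// (acm_F_xi acm).
  by have := beta_opp 0 Tb; rewrite oppr0; lra.
rewrite (only_VVV Ta)// (horizontal_of_B Ta)// F_perp bE//.
rewrite !delta_Phi_horizontal// /Phi.
rewrite !dot_FF !F_perp !FF !beta_opp// !linearNr /=.
rewrite !dot_perpl //.
rewrite /=; lra.
Qed.

(** * Classes determined by the covariant derivative of eta *)

(** The formula at (X, xi, F Y) compares the form (nabla eta) with its pullback
    by F and gives the sign t; at (F X, Y, xi) it compares (nabla_Y eta) X with
    (nabla_{F X} eta) (F Y), so that the two signs together give the
    symmetry. *)
Lemma nabla_eta_class (s t : R) a : s * s = 1 -> t * t = 1 -> T_space a ->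
  (forall X Y Z, a X Y Z = s * (eta Z * nabla_eta xi F a Y (F X))
                           + t * (eta Y * nabla_eta xi F a (F X) Z)) <->
  [/\ forall X Y, horizontal X -> horizontal Y ->
        B a X Y xi = - (s * t) * B a Y X xi /\
        B a (F X) (F Y) xi = t * B a X Y xi,
      zero_VVV dot xi (B a), zero_xiVxi dot xi (B a) & zero_xiVV dot xi (B a)].
Proof.
move=> ss tt Ta.
have Tb := B_T_space Ta; have tb := T_tri Tb.
have hp := perp_horizontal; have hF := F_horizontal.
split=> [aE|].
  have g_xi X : nabla_eta xi F a X xi = 0.
    by rewrite nabla_etaE// (T_diag Tb) oppr0.
  have zx Y Z : a xi Y Z = 0.
    rewrite aE (acm_F_xi acm) !nabla_etaE// (tri01 tb) (tri02 tb); ring.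
  have inv X Y : horizontal X -> horizontal Y ->
      B a (F X) (F Y) xi = t * B a X Y xi.
    move=> hX hY; have := aE X xi (F Y).
    rewrite -[LHS]/(nabla_eta xi F a X Y) !nabla_etaE// eta_F eta_xi => e.
    have -> : B a X Y xi = t * B a (F X) (F Y) xi by lra.
    by rewrite mulrA tt mul1r.
  split.
  - move=> X Y hX hY; split; last exact: inv.
    have := aE (F X) Y xi; rewrite (xi_of_B Ta) inv// g_xi nabla_etaE//.
    rewrite FF_horizontal// (triN2 tb) eta_xi => e.
    have {}e : t * B a X Y xi = - s * B a Y X xi by lra.
    by rewrite -[LHS]mul1r -tt -mulrA e; ring.
  - apply/zero_VVV_B => // X Y Z _ hY hZ.
    by rewrite aE (eta_horizontal hY) (eta_horizontal hZ); ring.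
  - by apply/zero_xiVxi_B => // *; exact: zx.
  - by apply/zero_xiVV_B => // *; exact: zx.
move=> [bE /(zero_VVV_B Ta) z1 xVx /(zero_xiVV_B Ta) z3] X Y Z.
have z2 := (zero_xiVxi_B Ta).1 xVx.
have tw U W : horizontal U -> horizontal W ->
    B a (F U) W xi = - t * B a U (F W) xi.
  move=> hU hW; have [_] := bE _ _ hU (hF W).
  by rewrite FF_horizontal// (triN2 tb); lra.
have bY : B a Y (F X) xi = s * B a (perp X) (F Y) xi.
  rewrite (split_arg1 Tb) (xVx _ (hF X)) mulr0 addr0.
  have [-> _] := bE _ _ (hp Y) (hF X).
  rewrite -[F X]F_perp tw// F_perp mulrA.
  by rewrite mulrNN -[s * t * t]mulrA tt mulr1.
have bZ : B a (F X) Z xi = - t * B a (perp X) (F Z) xi.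
  by rewrite -(perp_xi Tb) -[F X]F_perp tw// F_perp.
rewrite (only_VVxi Ta z1 z2 z3) !nabla_etaE// bY bZ !(xi_of_B Ta) !F_perp.
ring: ss tt.
Qed.

Lemma C7_iff_T5 a : T_space a -> C7 dot xi F E a <-> T5 dot xi F E (B a).
Proof.
move=> Ta; have Tb := B_T_space Ta; rewrite /C7 /T5 /= C_spaceE.
have [vc cv] := @nabla_eta_class 1 1 a (mul1r 1) (mul1r 1) Ta.
split=> [[_ aE d0]|[_ bE b0 [z1 z2 z3]]].
  have [|bE z1 z2 z3] := vc; first by move=> X Y Z; rewrite aE; ring.
  split=> // [X Y hX hY|].
    by have [e1 e2] := bE _ _ hX hY; split; [rewrite e1|rewrite e2]; ring.
  have := d0 xi; rewrite delta_Phi_vertical//; last 2 first.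
  - exact/zero_VVV_B.
  - exact/zero_xiVxi_B.
  by rewrite eta_xi mul1r.
split=> // [X Y Z|U].
  rewrite cv; first by ring.
  split=> // {}X {}Y hX hY.
  by have [e1 e2] := bE _ _ hX hY; split; [rewrite e1|rewrite e2]; ring.
rewrite delta_Phi_vertical ?b0 ?mulr0//.
- exact/zero_VVV_B.
- exact/zero_xiVxi_B.
Qed.

Lemma C8_iff_T8 a : T_space a -> C8 dot xi F E a <-> T8 dot xi F E (B a).
Proof.
move=> Ta; have Tb := B_T_space Ta; rewrite /C8 /T8 /= C_spaceE.
have NN : (- 1) * (- 1) = 1 :> R by ring.
have [vc cv] := @nabla_eta_class (-1) 1 a NN (mul1r 1) Ta.
rewrite delta_etaE//.
split=> [[_ aE d0]|[_ bE b0 [z1 z2 z3]]].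
  have [|bE z1 z2 z3] := vc; first by move=> X Y Z; rewrite aE; ring.
  split=> // X Y hX hY.
  by have [e1 e2] := bE _ _ hX hY; split; [rewrite e1|rewrite e2]; ring.
split=> // X Y Z; rewrite cv; first by ring.
split=> // {}X {}Y hX hY.
by have [e1 e2] := bE _ _ hX hY; split; [rewrite e1|rewrite e2]; ring.
Qed.

Lemma C9_iff_T9 a : T_space a -> C9 dot xi F a <-> T9 dot xi F (B a).
Proof.
move=> Ta; have Tb := B_T_space Ta; rewrite /C9 /T9 /= C_spaceE.
have NN : (- 1) * (- 1) = 1 :> R by ring.
have [vc cv] := @nabla_eta_class 1 (-1) a (mul1r 1) NN Ta.
split=> [[_ aE]|[_ bE z1 z2 z3]].
  have [|bE z1 z2 z3] := vc; first by move=> X Y Z; rewrite aE; ring.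
  split=> // X Y hX hY.
  by have [e1 e2] := bE _ _ hX hY; split; [rewrite e1|rewrite e2]; ring.
split=> // X Y Z; rewrite cv; first by ring.
split=> // {}X {}Y hX hY.
by have [e1 e2] := bE _ _ hX hY; split; [rewrite e1|rewrite e2]; ring.
Qed.

Lemma C10_iff_T6 a : T_space a -> C10 dot xi F a <-> T6 dot xi F (B a).
Proof.
move=> Ta; have Tb := B_T_space Ta; rewrite /C10 /T6 /= C_spaceE.
have NN : (- 1) * (- 1) = 1 :> R by ring.
have [vc cv] := @nabla_eta_class (-1) (-1) a NN NN Ta.
split=> [[_ aE]|[_ bE z1 z2 z3]].
  have [|bE z1 z2 z3] := vc; first by move=> X Y Z; rewrite aE; ring.
  split=> // X Y hX hY.
  by have [e1 e2] := bE _ _ hX hY; split; [rewrite e1|rewrite e2]; ring.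
split=> // X Y Z; rewrite cv; first by ring.
split=> // {}X {}Y hX hY.
by have [e1 e2] := bE _ _ hX hY; split; [rewrite e1|rewrite e2]; ring.
Qed.

Lemma C5_iff_T10 a : T_space a -> C5 dot xi F E a <-> T10 dot xi F E (B a).
Proof.
move=> Ta; have Tb := B_T_space Ta; rewrite /C5 /T10 /= C_spaceE.
rewrite delta_etaE//; set c := (2 * n%:R)^-1.
have hp := perp_horizontal; have hF := F_horizontal.
split=> [[_ aE]|[_ bE z1 z2 z3]].
  have zx Y Z : a xi Y Z = 0 by rewrite aE !Phi_xi; ring.
  split=> //.
  - move=> X Y hX hY; rewrite (B_xi Ta) aE /Phi eta_F eta_xi FF_horizontal//.
    by rewrite linearNr /=; ring.
  - apply/zero_VVV_B => // X Y Z _ hY hZ.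
    by rewrite aE (eta_horizontal hY) (eta_horizontal hZ); ring.
  - by apply/zero_xiVxi_B => // *; exact: zx.
  - by apply/zero_xiVV_B => // *; exact: zx.
split=> // X Y Z.
move/(zero_VVV_B Ta): z1 => z1; move/(zero_xiVxi_B Ta): z2 => z2.
move/(zero_xiVV_B Ta): z3 => z3.
rewrite (only_VVxi Ta z1 z2 z3) !(xi_of_B Ta) !F_perp !bE// /Phi !dot_perpl//.
by ring.
Qed.

Lemma C6_iff_T7 a : T_space a -> C6 dot xi F E a <-> T7 dot xi F E (B a).
Proof.
move=> Ta; have Tb := B_T_space Ta; rewrite /C6 /T7 /= C_spaceE.
set c := (2 * n%:R)^-1; have hp := perp_horizontal; have hF := F_horizontal.
split=> [[_ aE]|[_ bE z1 z2 z3]].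
  have xi_dot Y : '[xi, Y] = eta Y by exact: dotC.
  have zx Y Z : a xi Y Z = 0 by rewrite aE !xi_dot; ring.
  have z1 : zero_VVV dot xi a.
    move=> X Y Z _ hY hZ.
    by rewrite aE (eta_horizontal hY) (eta_horizontal hZ); ring.
  have z2 : zero_xiVxi dot xi a by move=> *; exact: zx.
  split=> //.
  - move=> X Y hX hY; rewrite (B_xi Ta) aE delta_Phi_vertical// eta_F eta_xi.
    by ring.
  - exact/zero_VVV_B.
  - exact/zero_xiVxi_B.
  - by apply/zero_xiVV_B => // *; exact: zx.
move/(zero_VVV_B Ta): z1 => z1; move/(zero_xiVxi_B Ta): z2 => z2.
move/(zero_xiVV_B Ta): z3 => z3.
split=> // X Y Z.
rewrite delta_Phi_vertical// eta_xi (only_VVxi Ta z1 z2 z3) !(xi_of_B Ta).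
rewrite !F_perp !bE// !FF !linearNr /= !dot_perp; ring.
Qed.

End Traces.

(** * Classes concentrated on the blocks starting with xi *)

Lemma C11_iff_T12 a : T_space a -> C11 dot xi F a <-> T12 dot xi F (B a).
Proof.
move=> Ta; have ta := T_tri Ta; have Tb := B_T_space Ta.
rewrite /C11 /T12 /= C_spaceE.
have hp := perp_horizontal.
split=> [[_ aE]|].
  have zxi X Y : a X Y xi = 0 by rewrite aE (acm_F_xi acm) (tri03 ta); ring.
  split=> //.
  - move=> X Y hX hY.
    by rewrite (T_FF Tb)// (T_skew Tb xi Y X); split; ring.
  - apply/zero_VVV_B => // X Y Z hX _ _.
    by rewrite aE (eta_horizontal hX); ring.
  - by apply/zero_VVxi_B => // *; exact: zxi.
  - by apply/zero_xiVxi_B => // *; exact: zxi.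
move=> [_ _ /(zero_VVV_B Ta) z1 /(zero_VVxi_B Ta) z2 /(zero_xiVxi_B Ta) z3].
split=> // X Y Z; rewrite (block_expand Ta) -(F_perp Y) -(F_perp Z) (T_FF Ta)//.
by rewrite z1// !z3// !z2//; ring.
Qed.

Lemma C12_iff_T11 a : T_space a -> C12 dot xi F a <-> T11 dot xi F (B a).
Proof.
move=> Ta; have Tb := B_T_space Ta.
rewrite /C12 /T11 /= C_spaceE.
have hp := perp_horizontal.
split=> [[_ aE]|].
  have z X Y Z : horizontal X -> a X Y Z = 0.
    by move=> hX; rewrite aE (eta_horizontal hX); ring.
  split=> //.
  - by apply/zero_VVV_B => // X Y Z hX _ _; exact: z.
  - by apply/zero_VVxi_B => // X Y hX _; exact: z.
  - apply/zero_xiVV_B => // Y Z hY hZ.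
    by rewrite aE (eta_horizontal hY) (eta_horizontal hZ); ring.
move=> [_ /(zero_VVV_B Ta) z1 /(zero_VVxi_B Ta) z2 /(zero_xiVV_B Ta) z3].
split=> // X Y Z; rewrite (block_expand Ta) !nabla_etaE// -!(xi_of_B Ta).
rewrite !(perp_xi Ta xi) z1// z3// !(z2 _ _ (hp X))//; ring.
Qed.

End AlmostContact.

(** * The correspondence of the classes *)

Lemma orthonormal_rcons (R : realType) (T : vectType R)
    (dot : {dot T for idfun}) (s : seq T) (v : T) :
  orthonormal dot (rcons s v) -> {in s, forall u, dot u v = 0}.
Proof.
case/andP=> _; elim: s => [|w s IHs] //=; rewrite andbT => /andP[wsv /IHs sv].
move=> u; rewrite inE => /orP[/eqP->|/sv//].
by apply/eqP/(allP wsv); rewrite mem_rcons mem_head.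
Qed.

Theorem theorem6p21 (R : realType) (n : nat) (hn : (2 <= n)%N)
    (T : vectType R) (dimT : \dim {:T} = n.*2.+1)
    (dot : {dot T for idfun}) (xi : T) (F : {linear T -> T})
    (acm : almost_contact_metric dot xi F)
    (E : 'I_n -> T) (frameE : orthonormal_frame dot xi F E) :
  [/\ submod_closed (mem (C_space dot xi F)),
      submod_closed (mem (T_space dot xi F)),
      linear (B dot xi F)
    & set_bij (C_space dot xi F) (T_space dot xi F) (B dot xi F)] /\
  [/\ [/\ B dot xi F @` C1 dot xi F = T1 dot xi F,
          B dot xi F @` C2 dot xi F = T2 dot xi F,
          B dot xi F @` C3 dot xi F E = T3 dot xi F E
        & B dot xi F @` C4 dot xi F E = T4 dot xi F E],
      [/\ B dot xi F @` C5 dot xi F E = T10 dot xi F E,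
          B dot xi F @` C6 dot xi F E = T7 dot xi F E,
          B dot xi F @` C7 dot xi F E = T5 dot xi F E
        & B dot xi F @` C8 dot xi F E = T8 dot xi F E]
    & [/\ B dot xi F @` C9 dot xi F = T9 dot xi F,
          B dot xi F @` C10 dot xi F = T6 dot xi F,
          B dot xi F @` C11 dot xi F = T12 dot xi F
        & B dot xi F @` C12 dot xi F = T11 dot xi F]].
Proof.
have hE i : xi_perp dot xi (E i).
  case: frameE => _; rewrite /frame catA cats1 => /orthonormal_rcons; apply.
  by rewrite mem_cat (map_f E) ?mem_enum.
split.
  split; [|exact: T_space_submod|exact: B_linear|exact: B_bij].
  by rewrite C_spaceE//; exact: T_space_submod.
split; split;
  (apply: (image_B_class acm); [by move=> ? []..|]).
all: move=> a Ta.
- exact: C1_iff_T1.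
- exact: C2_iff_T2.
- exact: C3_iff_T3.
- exact: C4_iff_T4.
- exact: C5_iff_T10.
- exact: C6_iff_T7.
- exact: C7_iff_T5.
- exact: C8_iff_T8.
- exact: C9_iff_T9.
- exact: C10_iff_T6.
- exact: C11_iff_T12.
- exact: C12_iff_T11.
Qed.
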